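(* Let $X$ be a non-empty set, let $f,g$ be permutations of $X$ with $fg=gf$, and let $(X,r)$ be the Lyubashenko solution $r(x,y)=(f(y),g(x))$ for $x,y\in X$. Then $(X,r)$ satisfies max-con if and only if any (equivalently, all) of the following equivalent properties holds: (1) $(X,r)$ is finitely generated; (2) $(X,r)$ satisfies max-sub; (3) $(X,r)$ satisfies min-sub; (4) $X$ has a finite number of orbits under the action of the group $\langle f,g\rangle\leq \operatorname{Sym}_X$.
   Context: A solution (of the Yang–Baxter equation) is a pair $(X,r)$ with $X$ a non-empty set and $r\colon X\times X\to X\times X$, $r(x,y)=(\lambda_x(y),\rho_y(x))$, such that $r_{12}r_{23}r_{12}=r_{23}r_{12}r_{23}$ on $X^3$, where $r_{12}=r\times\mathrm{id}_X$, $r_{23}=\mathrm{id}_X\times r$, and such that all maps $\lambda_x$ and $\rho_x$ are bijective (non-degeneracy). For commuting permutations $f,g$ of $X$, the map $r(x,y)=(f(y),g(x))$ gives a solution, called a Lyubashenko solution. A subsolution of $(X,r)$ is a subset $Y\subseteq X$ such that $r$ restricts to $Y\times Y$ and $(Y,r|_{Y\times Y})$ is a (non-degenerate) solution. For $Y\subseteq X$, $\overline{Y}$ is the intersection of all subsolutions of $(X,r)$ containing $Y$; $(X,r)$ is finitely generated if $X=\overline{Y}$ for some finite $Y\subseteq X$. A congruence of $(X,r)$ is an equivalence relation $\sim$ on $X$ such that $\overline{r}([x],[y])=([\lambda_x(y)],[\rho_y(x)])$ is well defined on $X/{\sim}$ and $(X/{\sim},\overline r)$ is a (non-degenerate) solution.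 $(X,r)$ satisfies max-sub (resp. min-sub) if the set of its subsolutions, ordered by inclusion, satisfies the maximal (resp. minimal) condition; it satisfies max-con if the set of its congruences, ordered by inclusion (as subsets of $X\times X$), satisfies the maximal condition. *)

(* Defs.v *)
From Stdlib Require Export RelationClasses.
From mathcomp Require Export all_boot.
From mathcomp Require Export boolp classical_sets functions cardinality.

Set Implicit Arguments.
Unset Strict Implicit.
Unset Printing Implicit Defensive.

Local Open Scope classical_set_scope.

Section Solutions.
Variable X : Type.
Implicit Type r : X * X -> X * X.

Definition lambda r (x y : X) : X := (r (x, y)).1.
Definition rho r (y x : X) : X := (r (x, y)).2.

Definition r12 r (t : X * X * X) : X * X * X :=
  let: (x, y, z) := t in (r (x, y), z).
Definition r23 r (t : X * X * X) : X * X * X :=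
  let: (x, y, z) := t in let: (y', z') := r (y, z) in (x, y', z').

Definition yang_baxter r : Prop :=
  r12 r \o r23 r \o r12 r = r23 r \o r12 r \o r23 r.

Definition nondegenerate r : Prop :=
  (forall x, bijective (lambda r x)) /\ (forall x, bijective (rho r x)).

Definition solution r : Prop :=
  [/\ inhabited X, yang_baxter r & nondegenerate r].

End Solutions.

Section Substructures.
Variable X : Type.
Implicit Types (r : X * X -> X * X) (Y : set X) (E : set (X * X)).

(* The witness [s] is the restriction of [r] to [Y * Y], which is unique;
   in particular a subsolution is non-empty. *)
Definition subsolution r : set (set X) := [set Y |
  exists2 s : set_type Y * set_type Y -> set_type Y * set_type Y,
    forall x y, (val (s (x, y)).1, val (s (x, y)).2) = r (val x, val y)
    & solution s].

Definition subsolution_closure r Y : set X := smallest (subsolution r) Y.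

Definition finitely_generated r : Prop :=
  exists2 Y, finite_set Y & subsolution_closure r Y = [set: X].

Definition eq_class E (x : X) : set X := [set y | E (x, y)].

Definition quotient E : Type := set_type (range (eq_class E)).

Definition to_quotient E (x : X) : quotient E :=
  exist _ (eq_class E x) (mem_set (imageT (eq_class E) x)).

(* Existence of [rbar], necessarily unique, is well-definedness of the induced
   map on the quotient. *)
Definition congruence r : set (set (X * X)) := [set E |
  Equivalence (fun x y => E (x, y)) /\
  exists2 rbar : quotient E * quotient E -> quotient E * quotient E,
    forall x y, rbar (to_quotient E x, to_quotient E y) =
      (to_quotient E (lambda r x y), to_quotient E (rho r y x))
    & solution rbar].

End Substructures.

Section ChainConditions.
Variable T : Type.
Implicit Types P F : set (set T).

Definition maximal_condition P : Prop := forall F, F `<=` P -> F !=set0 ->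
  exists2 M, F M & forall N, F N -> M `<=` N -> N = M.

Definition minimal_condition P : Prop := forall F, F `<=` P -> F !=set0 ->
  exists2 M, F M & forall N, F N -> N `<=` M -> N = M.

End ChainConditions.

Definition max_sub (X : Type) (r : X * X -> X * X) : Prop :=
  maximal_condition (subsolution r).
Definition min_sub (X : Type) (r : X * X -> X * X) : Prop :=
  minimal_condition (subsolution r).
Definition max_con (X : Type) (r : X * X -> X * X) : Prop :=
  maximal_condition (congruence r).

Section Permutations.
Variable X : Type.

Definition perm_subgroup : set (set (X -> X)) := [set G | [/\
  forall h, G h -> bijective h,
  G id,
  forall h k, G h -> G k -> G (h \o k) &
  forall h k, G h -> cancel h k -> cancel k h -> G k]].

Definition generated_subgroup (S : set (X -> X)) : set (X -> X) :=
  smallest perm_subgroup S.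

Definition orbit_of (G : set (X -> X)) (x : X) : set X := [set h x | h in G].

Definition orbits (G : set (X -> X)) : set (set X) := range (orbit_of G).

End Permutations.

Definition lyubashenko (X : Type) (f g : X -> X) (p : X * X) : X * X :=
  (f p.2, g p.1).

Lemma lyubashenko_solution (X : Type) (f g : X -> X) :
  inhabited X -> bijective f -> bijective g -> f \o g = g \o f ->
  solution (lyubashenko f g).
Proof.
move=> X0 bf bg fg; split=> //.
apply/funext => -[[x y] z] /=; congr (_, _, _).
exact: (esym (congr1 (@^~ y) fg)).
Qed.

(* Main.v *)
(** For [r(x, y) = (f y, g x)] a subsolution is a non-empty subset invariant
    under [<f, g>], and a congruence is an equivalence relation invariant under
    [<f, g>]. If there are finitely many orbits, with representatives [R], an
    invariant subset is determined by its trace on [R], so ascending and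
    descending chains of subsolutions stop. An invariant equivalence relation
    [E] is determined by the sets [{a | x E (a y)}] for [x], [y] in [R]; these
    are empty or cosets of subgroups of the noetherian group [Z * Z], so
    ascending chains of congruences stop.
    Conversely, a maximal element among the subsolutions with finitely many
    orbits is [X], and a minimal element among those whose complement has
    finitely many orbits is a single orbit. Finally [Y |-> diag(X) U (Y * Y)]
    is an order embedding of subsolutions into congruences, so max-con implies
    max-sub. *)
Require Import Defs.
From mathcomp Require Import all_boot boolp classical_sets functions cardinality.
From mathcomp Require Import ssralg ssrnum ssrint intdiv zify.

Set Implicit Arguments.
Unset Strict Implicit.
Unset Printing Implicit Defensive.

Local Open Scope classical_set_scope.

(** * Chain conditions and stationary sequences *)

(** Without a maximal element, iterating a choice of strictly larger elements gives a chain that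
    never repeats. The relation [le] is left arbitrary so that both inclusion and reverse inclusion
    fit. *)
Lemma chain_condition_max (T : Type) (le : T -> T -> Prop) (F : set T) :
  F !=set0 ->
  (forall u : nat -> T, (forall n, F (u n)) ->
     (forall n, le (u n) (u n.+1)) -> exists n, u n.+1 = u n) ->
  exists2 M, F M & forall N, F N -> le M N -> N = M.
Proof.
move=> [M0 FM0] chain; apply: contrapT => noM.
have next M : exists N, F M -> [/\ F N, le M N & N <> M].
  apply: contrapT => nN; apply: noM.
  have FM : F M by apply: contrapT => nFM; apply: nN; exists M.
  exists M => // N FN MN; apply: contrapT => NM.
  by apply: nN; exists N.
have [s sP] := choice next.
have Fs n : F (iter n s M0) by elim: n => //= n /sP[].
have [n /= e] := chain _ Fs (fun n => let: And3 _ le_s _ := sP _ (Fs n) in le_s).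
by have [_ _] := sP _ (Fs n); rewrite e.
Qed.

(** The maximum of the finitely many thresholds works for every [d]. It serves to treat all orbit
    representatives, or pairs of them, at one index. *)
Lemma eventually_forall_finite (T : Type) (D : set T) (Q : T -> nat -> Prop) :
  finite_set D ->
  (forall d, D d -> exists N, forall n, N <= n -> Q d n) ->
  exists n, forall d, D d -> Q d n.
Proof.
move=> finD QD.
have QD' d : exists N, D d -> forall n, N <= n -> Q d n.
  have [/QD[N QN]|nDd] := pselect (D d); first by exists N.
  by exists 0.
have [N NP] := choice QD'.
have /finite_seqP[s sE] := finite_image N finD.
exists (\max_(i <- s) i) => d Dd; apply: NP => //.
apply: (@leq_bigmax_seq _ _ xpredT id) => //.
by have : [set` s] (N d) by rewrite -sE; exists d.
Qed.

Definition stabilizes (T : Type) (H : nat -> set T) : Prop :=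
  exists N, forall n, N <= n -> H n.+1 `<=` H n.

Definition ascending (T : Type) (H : nat -> set T) : Prop :=
  forall n, H n `<=` H n.+1.

Lemma ascending_le (T : Type) (H : nat -> set T) m n :
  ascending H -> m <= n -> H m `<=` H n.
Proof.
move=> up /subnK <-; elim: (n - m) => //= k IH.
by apply: subset_trans IH (up _).
Qed.

Lemma stabilizes_at (T : Type) (H : nat -> set T) N :
  ascending H -> (forall n, H n `<=` H N) -> stabilizes H.
Proof.
move=> up HN; exists N => n leNn.
exact: subset_trans (HN _) (ascending_le up leNn).
Qed.

(** * Noetherian abelian groups *)

Import GRing.Theory Num.Theory.
Local Open Scope ring_scope.

Definition zsubgroup (A : zmodType) (H : set A) : Prop :=
  H 0 /\ forall x y, H x -> H y -> H (x - y).

Definition noetherian (A : zmodType) : Prop :=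
  forall H : nat -> set A,
    (forall n, zsubgroup (H n)) -> ascending H -> stabilizes H.

Section Subgroups.
Variables (A : zmodType) (H : set A).
Hypothesis sH : zsubgroup H.

Lemma zsubgroupN x : H x -> H (- x).
Proof. by case: sH => H0 HB Hx; rewrite -[- x]add0r; apply: HB. Qed.

Lemma zsubgroupD x y : H x -> H y -> H (x + y).
Proof.
by case: sH => H0 HB Hx Hy; rewrite -[y]opprK; apply/HB/zsubgroupN.
Qed.

Lemma zsubgroupMz x z : H x -> H (x *~ z).
Proof.
move=> Hx; have Hn n : H (x *+ n).
  elim: n => [|n IH]; first by case: sH.
  by rewrite mulrS; apply: zsubgroupD.
case: z => n; first by rewrite -pmulrn.
by rewrite NegzE mulrNz -pmulrn; apply: zsubgroupN.
Qed.

End Subgroups.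

(** The least positive element of the union of the chain lies in some [H N]; by Euclidean division
    it generates every later subgroup. *)
Lemma noetherian_int : noetherian int.
Proof.
move=> H sH up.
(* The shift to [k.+1] restricts the search to positive integers. *)
pose P k := `[< exists n, H n (k.+1)%:Z >].
have [exP|noP] := pselect (exists k, P k); last first.
  apply: (@stabilizes_at _ _ 0) => // n x Hx.
  have Hx' := zsubgroupN (sH n) Hx.
  case: x Hx Hx' => [[|k]|k] Hx Hx'; first by case: (sH 0%N).
    by case: noP; exists k; apply/asboolP; exists n.
  by case: noP; exists k; apply/asboolP; exists n; move: Hx'; rewrite NegzE opprK.
have [k /asboolP[N HN] kmin] := ex_minnP exP.
apply: (@stabilizes_at _ _ N) => // m x Hx; set d := k.+1%:Z in HN.
have d0 : d != 0 by [].
have Hd : H (maxn m N) d by apply: ascending_le HN => //; apply: leq_maxr.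
have Hx' : H (maxn m N) x by apply: ascending_le Hx => //; apply: leq_maxl.
(* Both [x] and [d] lie in the subgroup of index [maxn m N], hence so does the remainder. *)
have Hq : H (maxn m N) (x %% d)%Z.
  have -> : (x %% d)%Z = x - d *~ (x %/ d)%Z.
    by rewrite {2}(divz_eq x d) -mulrzr intz mulrC addrAC subrr add0r.
  by case: (sH (maxn m N)) => _; apply=> //; apply: zsubgroupMz.
have q0 : (x %% d)%Z = 0.
  have := modz_ge0 x d0; have := @ltz_pmod x d isT.
  (* A remainder [j.+1] below [d = k.+1] would contradict the minimality of [k]. *)
  case: (x %% d)%Z Hq => [[|j]|j] // Hj ltj _.
  have := kmin j; have -> : P j by apply/asboolP; exists (maxn m N).
  by move=> /(_ isT); move: ltj; rewrite /d; lia.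
rewrite (divz_eq x d) q0 addr0 mulrC -[(x %/ d)%Z]intz mulrzr.
exact: zsubgroupMz.
Qed.

(* Nested subgroups of [A * B] are equal as soon as they have the same
   intersection with [A] and the same projection to [B]. *)
Lemma noetherian_prod (A B : zmodType) :
  noetherian A -> noetherian B -> noetherian (A * B)%type.
Proof.
move=> nA nB H sH up.
pose K n := [set a | H n (a, 0)]; pose P n := [set b | exists a, H n (a, b)].
have sK n : zsubgroup (K n).
  have [H0 HB] := sH n; split=> // x y Kx Ky.
  by have := HB _ _ Kx Ky; rewrite /K /= -[_ - _]/(_, _) /= subrr.
have sP n : zsubgroup (P n).
  have [H0 HB] := sH n; split=> [|x y [a Ha] [b Hb]]; first by exists 0.
  by exists (a - b); have := HB _ _ Ha Hb.
have [N1 HN1] : stabilizes K by apply: nA => // n a; apply: up.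
have [N2 HN2] : stabilizes P.
  by apply: nB => // n b [a Ha]; exists a; apply: up.
exists (maxn N1 N2) => n; rewrite geq_max => /andP[le1 le2] [a b] Hab.
have [a' Ha'] : P n b by apply: HN2 => //; exists a.
have Kaa : K n (a - a').
  apply: HN1 => //; have [_ HB] := sH n.+1.
  by have := HB _ _ Hab (up _ _ Ha'); rewrite /K /= -[_ - _]/(_, _) /= subrr.
have := zsubgroupD (sH n) Kaa Ha'.
by rewrite -[_ + _]/(_, _) /= subrK add0r.
Qed.

(* The closure condition says that [S n] is empty or a coset of a subgroup. *)
Lemma noetherian_cosets (A : zmodType) (S : nat -> set A) : noetherian A ->
  (forall n a b c, S n a -> S n b -> S n c -> S n (a - b + c)) ->
  ascending S -> stabilizes S.
Proof.
move=> nA Scoset up.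
have [[N0 [a Sa]]|S0] := pselect (exists N, S N !=set0); last first.
  by exists 0%N => n _ a Sa; case: S0; exists n.+1, a.
have Sna n : S (N0 + n)%N a by apply: ascending_le Sa => //; apply: leq_addr.
(* Translation by the fixed element [a] turns the cosets from index [N0] on into subgroups. *)
have [N HN] : stabilizes (fun n => [set b | S (N0 + n)%N (b + a)]).
  apply: nA => [n|n b /=]; last by rewrite addnS; apply: up.
  split=> /= [|x y Sx Sy]; first by rewrite add0r.
  have := Scoset _ _ _ _ Sx Sy (Sna n).
  by rewrite opprD addrA [x + a - y]addrAC addrK.
exists (N0 + N)%N => n le_n b Sb.
have := HN (n - N0)%N _ (b - a); rewrite /= subrK addnS subnKC; last by lia.
by apply=> //; lia.
Qed.

(** * Actions of an abelian group and their orbits *)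

Section Action.
Variables (A : zmodType) (X : Type) (act : A -> X -> X).
Hypothesis X0 : inhabited X.
Hypothesis act0 : forall x, act 0 x = x.
Hypothesis actD : forall a b x, act (a + b) x = act a (act b x).

Definition act_orbit (x : X) : set X := range (act ^~ x).

(** Non-emptiness is included because a subsolution is non-empty. *)
Definition act_invariant : set (set X) :=
  [set Y | Y !=set0 /\ forall a x, Y x -> Y (act a x)].

Definition act_congruence : set (set (X * X)) :=
  [set E | Equivalence (fun x y => E (x, y)) /\
           forall a x y, E (x, y) -> E (act a x, act a y)].

Lemma actK a x : act (- a) (act a x) = x.
Proof. by rewrite -actD addNr. Qed.

Lemma act_orbit_refl x : act_orbit x x.
Proof. by exists 0. Qed.

Lemma act_orbit_eq x y : act_orbit x y -> act_orbit y = act_orbit x.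
Proof.
case=> a _ <-; apply/seteqP; split=> _ [b _ <-]; first by exists (b + a).
by exists (b - a) => //; rewrite actD actK.
Qed.

Lemma finite_orbits_of_orbit x : finite_set (act_orbit @` act_orbit x).
Proof.
apply: (sub_finite_set _ (finite_set1 (act_orbit x))).
by move=> _ [y xy <-]; apply: act_orbit_eq.
Qed.

Lemma act_orbit_invariant x : act_invariant (act_orbit x).
Proof.
split=> [|a _ [b _ <-]]; first by exists x; apply: act_orbit_refl.
by exists (a + b).
Qed.

Lemma act_orbit_sub (Y : set X) x : act_invariant Y -> Y x -> act_orbit x `<=` Y.
Proof. by move=> [_ iY] Yx _ [a _ <-]; apply: iY. Qed.

Lemma act_orbit_mem (Y : set X) x y :
  act_invariant Y -> act_orbit x y -> Y y -> Y x.
Proof. by move=> [_ iY] [a _ <-] /(iY (- a)); rewrite actK. Qed.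

Lemma finite_orbit_representatives :
  finite_set (range act_orbit) ->
  exists2 R, finite_set R & forall x, exists2 y, R y & act_orbit y x.
Proof.
move=> fin_orb; case: X0 => x0.
(* The point [x0] is a default value for sets that are not orbits, so that choice gives a total
   function. *)
have repP O : exists x, range act_orbit O -> O x.
  have [[x _ <-]|nO] := pselect (range act_orbit O); last by exists x0.
  by exists x => _; apply: act_orbit_refl.
have [rep {}repP] := choice repP.
exists (rep @` range act_orbit); first exact: finite_image.
move=> x; exists (rep (act_orbit x)); first by exists (act_orbit x) => //; exists x.
have -> : act_orbit (rep (act_orbit x)) = act_orbit x.
  by apply/act_orbit_eq/(repP (act_orbit x)); exists x.
exact: act_orbit_refl.
Qed.

(** * Chain conditions from finitely many orbits *)

Section FiniteOrbits.
Hypothesis fin_orb : finite_set (range act_orbit).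

Lemma act_invariant_max : maximal_condition act_invariant.
Proof.
move=> F FP F0; apply: chain_condition_max F0 _ => u Fu up.
have [R finR RX] := finite_orbit_representatives fin_orb.
have [y Ry|n Rn] :=
    eventually_forall_finite (Q := fun y n => u n.+1 y -> u n y) finR.
  have [[N uN]|nu] := pselect (exists N, u N y).
    by exists N => n leNn _; apply: ascending_le uN.
  by exists 0%N => n _ uy; case: nu; exists n.+1.
exists n; apply/seteqP; split=> // x ux; have [y Ry yx] := RX x.
have iu m : act_invariant (u m) by apply/FP/Fu.
apply: (act_orbit_sub (iu n) _ yx); apply: Rn => //.
exact: act_orbit_mem ux.
Qed.

Lemma act_invariant_min : minimal_condition act_invariant.
Proof.
move=> F FP F0.
apply: (chain_condition_max (le := fun Y Z => Z `<=` Y)) F0 _ => u Fu down.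
have [R finR RX] := finite_orbit_representatives fin_orb.
have [y Ry|n Rn] :=
    eventually_forall_finite (Q := fun y n => u n y -> u n.+1 y) finR.
  have [[N uN]|nu] := pselect (exists N, ~ u N y).
    exists N => n leNn uny; case: uN; move: uny.
    (* Complements of a descending chain ascend, so once [y] has left the chain it stays out. *)
    have upC : ascending (fun n => ~` u n) by move=> m; apply: subsetC.
    by apply: contraPP; apply: (ascending_le upC leNn).
  by exists 0%N => n _ _; apply: contrapT => nuy; apply: nu; exists n.+1.
exists n; apply/seteqP; split=> // x ux; have [y Ry yx] := RX x.
have iu m : act_invariant (u m) by apply/FP/Fu.
apply: (act_orbit_sub (iu n.+1) _ yx); apply: Rn => //.
exact: act_orbit_mem ux.
Qed.

Lemma act_congruence_max : noetherian A -> maximal_condition act_congruence.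
Proof.
move=> nA F FP F0; apply: chain_condition_max F0 _ => u Fu up.
have [R finR RX] := finite_orbit_representatives fin_orb.
(* The elements carrying the second representative into the class of the first. *)
pose S (p : X * X) n := [set a | u n (p.1, act a p.2)].
have [p _|n Rn] := eventually_forall_finite
    (Q := fun p n => S p n.+1 `<=` S p n) (finite_setX finR finR).
  apply: (noetherian_cosets nA) => [n a b c|n a]; last exact: up.
  have [[_ sym trans] inv] := FP _ (Fu n).
  rewrite /S /= => Ea Eb Ec.
  (* From [b y ~ x ~ c y], translation by [a - b] gives [a y ~ (a - b + c) y], and [x ~ a y]. *)
  have := inv (a - b) _ _ (trans _ _ _ (sym _ _ Eb) Ec).
  rewrite -!actD subrK => Eac; exact: trans Ea Eac.
exists n; apply/seteqP; split=> // -[x y] uxy.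
have [x' Rx' [a _ xE]] := RX x; have [y' Ry' [b _ yE]] := RX y.
have [_ inv] := FP _ (Fu n); have [_ inv'] := FP _ (Fu n.+1).
(* With [x = a x'] and [y = b y'], translation by [- a] turns [x ~ y] into [x' ~ (b - a) y']. *)
have := Rn (x', y') _ (b - a); rewrite /S /= => /(_ (conj Rx' Ry')) Sn.
have := inv a _ _ (Sn _); rewrite -actD [a + _]addrC subrK xE yE; apply.
have := inv' (- a) _ _ uxy.
by rewrite -xE -yE actK -actD [- a + _]addrC.
Qed.

End FiniteOrbits.

(** * Finitely many orbits from chain conditions and from finite generation *)

Lemma finite_orbits_of_max :
  maximal_condition act_invariant -> finite_set (range act_orbit).
Proof.
move=> maxP; case: X0 => x0.
pose F := [set Y | act_invariant Y /\ finite_set (act_orbit @` Y)].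
have /maxP[|M [iM finM] maxM] : F `<=` act_invariant by move=> Y [].
  exists (act_orbit x0); split; first exact: act_orbit_invariant.
  exact: finite_orbits_of_orbit.
apply: (sub_finite_set _ finM) => _ [x _ <-]; exists x => //.
(* Adjoining one orbit stays in [F], so maximality puts [x] in [M]. *)
have <- : M `|` act_orbit x = M; last by right; apply: act_orbit_refl.
apply: maxM; last by left.
split.
  split=> [|a y [My|xy]]; first by have [[m Mm] _] := iM; exists m; left.
    by left; apply: (iM.2).
  by right; apply: (act_orbit_invariant x).2.
by rewrite image_setU finite_setU; split=> //; apply: finite_orbits_of_orbit.
Qed.

Lemma finite_orbits_of_min :
  minimal_condition act_invariant -> finite_set (range act_orbit).
Proof.
move=> minP; case: X0 => x0.
pose F := [set Y | act_invariant Y /\ finite_set (act_orbit @` (~` Y))].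
have /minP[|M [iM finM] minM] : F `<=` act_invariant by move=> Y [].
  exists setT; split; first by split=> //; exists x0.
  by rewrite setCT image_set0.
have [m Mm] := iM.1.
have fin_m : finite_set (act_orbit @` (~` M) `|` [set act_orbit m]).
  by rewrite finite_setU.
apply: (sub_finite_set _ fin_m) => _ [x _ <-].
have [Mx|nMx] := pselect (M x); last by left; exists x.
right; apply: contrapT => /= xm.
(* If [x] in [M] lay outside the orbit of [m], removing this orbit would leave a set still in [F],
   non-empty because of [x]; minimality would make it equal to [M], which contains [m]. *)
suff : (M `\` act_orbit m) m by case=> _; apply; apply: act_orbit_refl.
rewrite (minM (M `\` act_orbit m)) //.
split.
  split=> [|a y [My my]].
    by exists x; split=> // mx; apply: xm; apply: act_orbit_eq.
  split; first exact: iM.2.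
  by move=> may; apply: my; apply: act_orbit_mem may;
    [apply: act_orbit_invariant|exists a].
apply: sub_finite_set fin_m => _ [y /= nMy <-].
have [My|nMy'] := pselect (M y); last by left; exists y.
by right; apply: act_orbit_eq; apply: contrapT => my; apply: nMy.
Qed.

Lemma finite_orbits_of_generated :
  (exists2 Y, finite_set Y & smallest act_invariant Y = setT) ->
  finite_set (range act_orbit).
Proof.
move=> [Y finY YT]; case: X0 => x0.
(* [x0] is needed since the empty set generates [X] if there is one orbit. *)
have finY' : finite_set (Y `|` [set x0]) by rewrite finite_setU.
apply: sub_finite_set (finite_image act_orbit finY') => _ [x _ <-].
(* This union of finitely many orbits is invariant and contains [Y], hence contains the closure of
   [Y]. *)
pose Z := [set x | exists2 y, (Y `|` [set x0]) y & act_orbit y x].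
have [y Yy xy] : Z x.
  have : smallest act_invariant Y x by rewrite YT.
  apply: smallest_sub => [|y Yy]; last first.
    by exists y; [left|apply: act_orbit_refl].
  split=> [|a y [z Yz yz]].
    by exists x0, x0; [right|apply: act_orbit_refl].
  by exists z => //; apply: (act_orbit_invariant z).2.
by exists y => //; apply/esym/act_orbit_eq.
Qed.

Lemma generated_of_finite_orbits :
  finite_set (range act_orbit) ->
  exists2 Y, finite_set Y & smallest act_invariant Y = setT.
Proof.
move=> /finite_orbit_representatives[R finR RX]; exists R => //.
apply/seteqP; split=> // x _ Y [iY RY]; have [y /RY Yy yx] := RX x.
exact: act_orbit_sub yx.
Qed.

(** * Rees congruences *)

(** Collapses [Y] to one point, like the Rees congruence of an ideal in a semigroup. *)
Definition rees (Y : set X) : set (X * X) :=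
  [set p | p.1 = p.2 \/ Y p.1 /\ Y p.2].

Lemma rees_congruence (Y : set X) : act_invariant Y -> act_congruence (rees Y).
Proof.
move=> [_ iY]; split; last first.
  by move=> a x y [/= ->|[/= Yx Yy]]; [left|right; split; apply: iY].
split=> [x|x y [/= ->|[/= Yx Yy]]|x y z [/= ->|[/= Yx Yy]] [/= <-|[/= Yy' Yz]]];
  by [left|right].
Qed.

Lemma act_invariant_max_of_congruence :
  maximal_condition act_congruence -> maximal_condition act_invariant.
Proof.
move=> maxC F FP [Y0 FY0].
have /maxC[|_ [M FM <-] maxM] : rees @` F `<=` act_congruence.
  by move=> _ [Y /FP iY <-]; apply: rees_congruence.
  by exists (rees Y0), Y0.
exists M => // N FN MN.
have reesE : rees N = rees M.
  apply: maxM; first by exists N.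
  by move=> p [|[/MN ? /MN ?]]; [left|right].
apply/seteqP; split=> // y Ny; have [[m Mm] _] := FP _ FM.
(* A point [m] of [M] recovers [N]: being related to [m] under [rees M] means being [m] itself or
   lying in [M]. *)
have : rees N (m, y) by right; split=> //; apply: MN.
by rewrite reesE => -[/= <-|[]].
Qed.

End Action.

(** * Quotients by equivalence relations *)

Lemma to_quotient_eqP (X : Type) (E : set (X * X)) :
  Equivalence (fun x y => E (x, y)) ->
  forall x y, to_quotient E x = to_quotient E y <-> E (x, y).
Proof.
move=> [refl sym trans] x y; split=> [/(congr1 val) /= e|Exy].
  by have : eq_class E y y by []; rewrite -e.
apply: val_inj; apply/seteqP; split=> z /=; first exact/trans/sym.
exact: trans.
Qed.

Lemma to_quotient_surj (X : Type) (E : set (X * X)) (q : quotient E) :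
  exists x, to_quotient E x = q.
Proof.
by case: q => C memC; have [x _ xC] := set_mem memC; exists x; apply: val_inj.
Qed.

(** * Integer powers of a permutation, restrictions and induced maps *)

Section IntegerIterates.
Variables (X : Type) (f f' : X -> X).
Hypotheses (fK : cancel f f') (f'K : cancel f' f).

Definition ziter (z : int) : X -> X :=
  match z with Posz n => iter n f | Negz n => iter n.+1 f' end.

Lemma ziterS z x : ziter (1 + z) x = f (ziter z x).
Proof.
case: z => [n|[|n]]; [by rewrite -intS|exact/esym/f'K|].
have -> : 1 + Negz n.+1 = Negz n by lia.
by rewrite /= f'K.
Qed.

Lemma ziterD y z x : ziter (y + z) x = ziter y (ziter z x).
Proof.
elim: y => [|n IH|n IH]; first by rewrite add0r.
  by rewrite intS -addrA !ziterS IH.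
(* For negative exponents, applying the injective [f] to both sides raises the exponent by one and
   leads back to [IH]. *)
have fI := can_inj fK.
by apply: fI; rewrite -!ziterS addrA intS opprD [1 + (- 1 + _)]addrA subrr add0r IH.
Qed.

Lemma ziter_comm (h : X -> X) z x :
  (forall y, h (f y) = f (h y)) -> h (ziter z x) = ziter z (h x).
Proof.
move=> hf; have hf' y : h (f' y) = f' (h y).
  by rewrite -[LHS]fK -hf f'K.
have iterP k n : (forall y, h (k y) = k (h y)) -> h (iter n k x) = iter n k (h x).
  by move=> hk; elim: n => //= n <-.
by case: z => n; apply: iterP.
Qed.

Lemma ziter_rel (P : X -> X -> Prop) :
  (forall x y, P x y -> P (f x) (f y)) ->
  (forall x y, P x y -> P (f' x) (f' y)) ->
  forall z x y, P x y -> P (ziter z x) (ziter z y).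
Proof.
move=> Pf Pf'; have iterP k n x y :
    (forall x y, P x y -> P (k x) (k y)) -> P x y -> P (iter n k x) (iter n k y).
  by move=> Pk Pxy; elim: n => //= n; apply: Pk.
by case=> n x y; apply: iterP.
Qed.

Lemma ziter_closed (Y : set X) :
  (forall x, Y x -> Y (f x)) -> (forall x, Y x -> Y (f' x)) ->
  forall z x, Y x -> Y (ziter z x).
Proof.
move=> Yf Yf' z x.
(* A subset is treated as a relation that ignores its second argument. *)
by apply: (@ziter_rel (fun u _ => Y u) _ _ z x x) => u _; [apply: Yf|apply: Yf'].
Qed.

Lemma perm_subgroup_ziter (G : set (X -> X)) z :
  perm_subgroup G -> G f -> G f' -> G (ziter z).
Proof.
move=> [_ Gid Gcomp _] Gf Gf'.
have Giter k n : G k -> G (iter n k).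
  move=> Gk; elim: n => [//|n IH]; exact: Gcomp Gk IH.
by case: z => n; apply: Giter.
Qed.

(** The restriction of [f'] inverts that of [f]; stability under [f] alone would only give
    injectivity. *)
Lemma restriction_bijective (Y : set X) :
  (forall x, Y x -> Y (f x)) -> (forall x, Y x -> Y (f' x)) ->
  exists k : set_type Y -> set_type Y,
    (forall x, val (k x) = f (val x)) /\ bijective k.
Proof.
move=> Yf Yf'.
pose restr h (Yh : forall x, Y x -> Y (h x)) (x : set_type Y) : set_type Y :=
  exist _ (h (val x)) (mem_set (Yh _ (set_valP x))).
exists (restr f Yf); split=> //.
by exists (restr f' Yf') => x; apply: val_inj; rewrite /= ?fK ?f'K.
Qed.

Lemma quotient_bijective (E : set (X * X)) :
  Equivalence (fun x y => E (x, y)) ->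
  (forall x y, E (x, y) -> E (f x, f y)) ->
  (forall x y, E (x, y) -> E (f' x, f' y)) ->
  exists k : quotient E -> quotient E,
    (forall x, k (to_quotient E x) = to_quotient E (f x)) /\ bijective k.
Proof.
move=> eqE Ef Ef'.
have [rep repK] := choice (@to_quotient_surj X E).
(* The map is evaluated at a chosen representative; compatibility with [E] makes the choice
   irrelevant. *)
pose ind h q := to_quotient E (h (rep q)).
have indE h : (forall x y, E (x, y) -> E (h x, h y)) ->
    forall x, ind h (to_quotient E x) = to_quotient E (h x).
  by move=> Eh x; apply/(to_quotient_eqP eqE)/Eh/(to_quotient_eqP eqE).
exists (ind f); split; first exact: indE.
by exists (ind f') => q; have [x <-] := to_quotient_surj q; rewrite !indE ?fK ?f'K.
Qed.

End IntegerIterates.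

(** * Lyubashenko solutions as actions of the group of pairs of integers *)

Section Lyubashenko.
Variables (X : Type) (f f' g g' : X -> X).
Hypotheses (fK : cancel f f') (f'K : cancel f' f).
Hypotheses (gK : cancel g g') (g'K : cancel g' g).
Hypothesis fg : f \o g = g \o f.

Let r := lyubashenko f g.

(** The pair [(m, n)] acts as [f^m g^n]. Acting by [int * int] instead of its image [<f, g>] makes
    the noetherian property directly available. *)
Definition zact (a : int * int) (x : X) : X :=
  ziter f f' a.1 (ziter g g' a.2 x).

Lemma zact0 x : zact 0 x = x.
Proof. by []. Qed.

Lemma zactD a b x : zact (a + b) x = zact a (zact b x).
Proof.
rewrite /zact /= (ziterD fK f'K) (ziterD gK g'K); congr ziter.
(* A power of [f] has to pass a power of [g]: [ziter_comm] handles one exponent at a time. *)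
apply: ziter_comm => // y; apply/esym/ziter_comm => // {}y.
exact: (congr1 (@^~ y) (esym fg)).
Qed.

Lemma orbit_generated_zact x :
  orbit_of (generated_subgroup [set f; g]) x = act_orbit zact x.
Proof.
have zactK a : cancel (zact a) (zact (- a)).
  by move=> y; rewrite -zactD addNr.
have zactVK a : cancel (zact (- a)) (zact a).
  by move=> y; rewrite -zactD addrN.
apply/seteqP; split=> [_ [h hG <-]|_ [a _ <-]].
  (* The maps [zact a] form a subgroup containing [f] and [g], hence contain the generated one. *)
  suff : range zact h by case=> a _ <-; exists a.
  apply: smallest_sub hG => [|_ [->|->]]; last 2 first.
  - by exists (1, 0).
  - by exists (0, 1).
  split=> [_ [a _ <-]||_ _ [a _ <-] [b _ <-]|_ k [a _ <-] hk kh].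
  - by exists (zact (- a)).
  - by exists 0.
  - by exists (a + b) => //; apply/funext => y; rewrite zactD.
  - exists (- a) => //; apply/funext => y.
    by rewrite -[LHS]hk zactVK.
exists (zact a) => // G [sG fgG].
have [_ _ Gcomp Ginv] := sG.
have Gf : G f by apply: fgG; left.
have Gg : G g by apply: fgG; right.
apply: (Gcomp (ziter f f' a.1)); apply: perm_subgroup_ziter => //.
  exact: Ginv Gf fK f'K.
exact: Ginv Gg gK g'K.
Qed.

Lemma lyubashenko_subsolution : subsolution r = act_invariant zact.
Proof.
apply/seteqP; split=> Y; last first.
  move=> [[y0 Yy0] iY].
  have [k [kE bk]] : exists k : set_type Y -> set_type Y,
      (forall x, val (k x) = f (val x)) /\ bijective k.
    apply: (restriction_bijective fK f'K) => x; first exact: (iY (1, 0)).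
    exact: (iY (- 1, 0)).
  have [l [lE bl]] : exists l : set_type Y -> set_type Y,
      (forall x, val (l x) = g (val x)) /\ bijective l.
    apply: (restriction_bijective gK g'K) => x; first exact: (iY (0, 1)).
    exact: (iY (0, - 1)).
  exists (lyubashenko k l) => [x y|]; first by rewrite /= kE lE.
  apply: lyubashenko_solution => //; first by constructor; exists y0; rewrite inE.
  apply/funext => x; apply: val_inj; rewrite /= kE lE lE kE.
  exact: (congr1 (@^~ (val x)) fg).
move=> [s sE [[[y0 /set_mem Yy0]] _ [bl br]]].
have sfE x y : val (s (x, y)).1 = f (val y) by have [] := sE x y.
have sgE x y : val (s (x, y)).2 = g (val x) by have [] := sE x y.
pose z0 : set_type Y := exist _ y0 (mem_set Yy0).
have Yf x : Y x -> Y (f x).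
  by move=> /mem_set Yx; rewrite -(sfE z0 (exist _ x Yx)); apply: set_valP.
have Yg x : Y x -> Y (g x).
  by move=> /mem_set Yx; rewrite -(sgE (exist _ x Yx) z0); apply: set_valP.
(* Closure under the inverses comes from non-degeneracy: [lambda] and [rho] of [s] at [z0] are onto
   and restrict [f] and [g]. *)
have YfV x : Y x -> Y (f' x).
  move=> /mem_set Yx; have [t _ tK] := bl z0.
  have := congr1 val (tK (exist _ x Yx)); rewrite /lambda sfE /= => <-.
  by rewrite fK; apply: set_valP.
have YgV x : Y x -> Y (g' x).
  move=> /mem_set Yx; have [t _ tK] := br z0.
  have := congr1 val (tK (exist _ x Yx)); rewrite /rho sgE /= => <-.
  by rewrite gK; apply: set_valP.
split=> [|a x Yx]; first by exists y0.
by apply: ziter_closed => //; apply: ziter_closed.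
Qed.

Lemma lyubashenko_congruence :
  inhabited X -> congruence r = act_congruence zact.
Proof.
move=> [x0]; apply/seteqP; split=> E [eqE].
  move=> [s sE [_ _ [bl br]]].
  have toP := to_quotient_eqP eqE.
  (* Right to left, [s] is well defined on classes; left to right, [lambda s] at the class of [x0]
     is injective. The latter yields compatibility with [f']. *)
  have Ef x y : E (f x, f y) <-> E (x, y).
    have sfE z : lambda s (to_quotient E x0) (to_quotient E z) =
        to_quotient E (f z).
      by rewrite /lambda sE.
    by rewrite -!toP -!sfE; split=> [|-> //]; apply: bij_inj.
  have Eg x y : E (g x, g y) <-> E (x, y).
    have sgE z : rho s (to_quotient E x0) (to_quotient E z) =
        to_quotient E (g z).
      by rewrite /rho sE.
    by rewrite -!toP -!sgE; split=> [|-> //]; apply: bij_inj.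
  split=> // a x y Exy.
  apply: (ziter_rel (P := fun x y => E (x, y))) => [{x y Exy}x y /Ef//|{x y Exy}x y|].
    by rewrite -{1}[x]f'K -{1}[y]f'K => /Ef.
  apply: (ziter_rel (P := fun x y => E (x, y))) => // [{x y Exy}x y /Eg//|{x y Exy}x y].
  by rewrite -{1}[x]g'K -{1}[y]g'K => /Eg.
move=> inv; split=> //.
have [k [kE bk]] := quotient_bijective fK f'K eqE (inv (1, 0)) (inv (- 1, 0)).
have [l [lE bl]] := quotient_bijective gK g'K eqE (inv (0, 1)) (inv (0, - 1)).
exists (lyubashenko k l) => [x y|]; first by rewrite /lyubashenko /= kE lE.
apply: lyubashenko_solution => //; first by constructor; exact: to_quotient x0.
apply/funext => q; have [x <-] := to_quotient_surj q.
by rewrite /= kE lE lE kE; congr to_quotient; apply: (congr1 (@^~ x) fg).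
Qed.

End Lyubashenko.

Theorem theorem4p14 (X : Type) (f g : X -> X) :
  inhabited X -> bijective f -> bijective g -> f \o g = g \o f ->
  let r := lyubashenko f g in
  [/\ max_con r <-> finitely_generated r,
      finitely_generated r <-> max_sub r,
      max_sub r <-> min_sub r &
      min_sub r <-> finite_set (orbits (generated_subgroup [set f; g]))].
Proof.
move=> X0 [f' fK f'K] [g' gK g'K] fg r.
have a0 := zact0 f f' g g'.
have aD := zactD fK f'K gK g'K fg.
rewrite /max_con /max_sub /min_sub /finitely_generated /subsolution_closure /r.
rewrite (lyubashenko_subsolution fK f'K gK g'K fg).
rewrite (lyubashenko_congruence fK f'K gK g'K fg X0).
have -> : orbits (generated_subgroup [set f; g]) =
    range (act_orbit (zact f f' g g')).
  rewrite /orbits; congr image; apply/funext => x.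
  exact: orbit_generated_zact.
(* Each property is compared with finiteness of the set of orbits; max-con reaches it through
   max-sub. *)
have max_fin := finite_orbits_of_max X0 a0 aD.
have min_fin := finite_orbits_of_min X0 a0 aD.
have gen_fin := finite_orbits_of_generated X0 a0 aD.
have fin_max := act_invariant_max X0 a0 aD.
have fin_min := act_invariant_min X0 a0 aD.
have fin_gen := generated_of_finite_orbits X0 a0 aD.
have nZ2 := noetherian_prod noetherian_int noetherian_int.
have fin_con := fun fin => act_congruence_max X0 a0 aD fin nZ2.
have con_max := @act_invariant_max_of_congruence _ _ (zact f f' g g').
by split; split; auto.
Qed.
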